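(* Let $v:[t_0,T_q)\to\mathbb{R}^{N_xN_y}$ be the solution of the semi-discretized system $$v'(t)=Mv(t)+g(\varepsilon,v(t)),\quad t_0<t<T_q,\qquad v(t_0)=v_0,$$ with components satisfying $0\le u<1$ (that is, $0\le v(t)<1$ for $t_0\le t<T_q$). If $Mv_0+g(\varepsilon,v_0)>0$, then $v$ is monotonically increasing with respect to $t\in(t_0,T_q)$, i.e. $v(s)<v(t)$ whenever $t_0<s<t<T_q$.
   Context: All vector inequalities are componentwise. Mesh: $\mathcal{D}=(-1,1)\times(-1,1)$, $a,b>0$, $N_x,N_y$ are (large) positive integers, $-1=x_0<x_1<\dots<x_{N_x+1}=1$, $-1=y_0<\dots<y_{N_y+1}=1$, $h_{x,i}=x_{i+1}-x_i>0$ ($0\le i\le N_x$), $h_{y,j}=y_{j+1}-y_j>0$ ($0\le j\le N_y$); the mesh is otherwise arbitrary. The degeneracy function $\sigma:\overline{\mathcal{D}}\to[0,\infty)$ vanishes only on a subset of $\partial\mathcal{D}$; $\sigma_{i,j}=\sigma(x_i,y_j)$. Interior grid vectors $v=(v_{1,1},v_{2,1},\dots,v_{N_x,1},v_{1,2},\dots,v_{N_x,N_y})^{T}\in\mathbb{R}^{N_xN_y}$ are ordered lexicographically. Matrices: $B=\mathrm{diag}(\sigma_{1,1}^{-1},\sigma_{2,1}^{-1},\dots,\sigma_{N_x,N_y}^{-1})$ (same ordering); for $\alpha\in\{x,y\}$, $T_\alpha\in\mathbb{R}^{N_\alpha\times N_\alpha}$ is tridiagonal with $(T_\alpha)_{i,i}=-\frac{2}{h_{\alpha,i-1}h_{\alpha,i}}$,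 $(T_\alpha)_{i,i+1}=\frac{2}{h_{\alpha,i}(h_{\alpha,i-1}+h_{\alpha,i})}$, $(T_\alpha)_{i+1,i}=\frac{2}{h_{\alpha,i}(h_{\alpha,i}+h_{\alpha,i+1})}$; $M=a^{-2}B(I_{N_y}\otimes T_x)+b^{-2}B(T_y\otimes I_{N_x})$. Reaction term: $\varepsilon=\varepsilon(x,y)$ is a bounded stochastic influence (fixed in time). For each value of $\varepsilon$, $f(\varepsilon,\cdot)$ is a continuously differentiable function on $[0,1)$ with $f(\varepsilon,0)>0$, $f_u(\varepsilon,u)>0$, $\lim_{u\to1^-}f(\varepsilon,u)=\infty$, $\int_0^1 f(\varepsilon,u)\,du=\infty$, and for each $u\in[0,1)$ the values $f(\varepsilon,u)$ are bounded above and bounded below by a positive constant as $\varepsilon$ varies. For $v\in[0,1)^{N_xN_y}$, $g(\varepsilon,v)$ is the vector with components $f(\varepsilon(x_i,y_j),v_{i,j})/\sigma_{i,j}$. *)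

(* Defs.v *)
From HB Require Import structures.
From mathcomp Require Import all_boot all_order all_algebra.
From mathcomp Require Import all_classical all_reals all_analysis.
From mathcomp Require Import mxtens.

Set Implicit Arguments.
Unset Strict Implicit.
Unset Printing Implicit Defensive.

Import Order.TTheory GRing.Theory Num.Theory.
Import numFieldNormedType.Exports.

Local Open Scope classical_set_scope.
Local Open Scope ring_scope.

Definition vlt (R : realType) (n : nat) (u w : 'cV[R]_n) : Prop :=
  forall k, u k 0 < w k 0.

Definition vle (R : realType) (n : nat) (u w : 'cV[R]_n) : Prop :=
  forall k, u k 0 <= w k 0.

(* Mesh points are numbered from 0 to N.+1; only x 0, ..., x N.+1 matter. *)
Definition is_mesh (R : realType) (N : nat) (x : nat -> R) : Prop :=
  [/\ x 0%N = -1, x N.+1 = 1 & forall i, (i <= N)%N -> x i < x i.+1].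

Definition step (R : realType) (x : nat -> R) (i : nat) : R := x i.+1 - x i.

(* The indices i, j : 'I_N start at 0, so row i here is row i+1 in the usual
   numbering 1..N of the interior mesh points. *)
Definition tridiag (R : realType) (N : nat) (x : nat -> R) : 'M[R]_N :=
  let h := step x in
  \matrix_(i, j)
    if j == i :> nat then - (2 / (h i * h i.+1))
    else if j == i.+1 :> nat then 2 / (h i.+1 * (h i + h i.+1))
    else if i == j.+1 :> nat then 2 / (h j.+1 * (h j.+1 + h j.+2))
    else 0.

(* Lexicographic numbering with the x-index running fastest: the position
   k : 'I_(Ny * Nx) is j * Nx + i with j < Ny and i < Nx, which is also the
   index convention of the Kronecker product [*t]. *)
Definition node (R : realType) (Nx Ny : nat) (x y : nat -> R)
    (k : 'I_(Ny * Nx)) : R * R :=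
  let ji := mxtens_unindex k in (x ji.2.+1, y ji.1.+1).

Definition Bmx (R : realType) (Nx Ny : nat) (x y : nat -> R)
    (sigma : R * R -> R) : 'M[R]_(Ny * Nx) :=
  diag_mx (\row_k (sigma (node x y k))^-1).

Definition Mmx (R : realType) (Nx Ny : nat) (a b : R) (x y : nat -> R)
    (sigma : R * R -> R) : 'M[R]_(Ny * Nx) :=
  a ^- 2 *: (Bmx Nx Ny x y sigma *m ((1%:M : 'M[R]_Ny) *t tridiag Nx x))
  + b ^- 2 *: (Bmx Nx Ny x y sigma *m (tridiag Ny y *t (1%:M : 'M[R]_Nx))).

Definition gvec (R : realType) (Nx Ny : nat) (x y : nat -> R)
    (sigma : R * R -> R) (f : R -> R -> R) (eps : R * R -> R)
    (v : 'cV[R]_(Ny * Nx)) : 'cV[R]_(Ny * Nx) :=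
  \col_k (f (eps (node x y k)) (v k 0) / sigma (node x y k)).

Definition square (R : realType) : set (R * R) :=
  `]-1, 1[%classic `*` `]-1, 1[%classic.

Definition degeneracy (R : realType) (sigma : R * R -> R) : Prop :=
  (forall p : R * R, closure (@square R) p -> 0 <= sigma p) /\
  (forall p : R * R, closure (@square R) p -> sigma p = 0 ->
     (closure (@square R) `\` interior (@square R)) p).

(* Derivative relative to a set; one-sided at an endpoint of an interval. *)
Definition is_derive_within (R : realType) (A : set R) (phi : R -> R)
    (u l : R) : Prop :=
  (phi w - phi u) / (w - u) @[w --> within A u^'] --> l.

(* E is the set of values taken by the stochastic influence; f e u is only
   meaningful for e in E and 0 <= u < 1. *)
Definition reaction (R : realType) (E : set R) (f : R -> R -> R) : Prop :=
  (forall e, E e ->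
    [/\ exists2 fu : R -> R,
          {within `[0, 1[%classic, continuous fu} &
          forall u : R, 0 <= u < 1 ->
            is_derive_within `[0, 1[%classic (f e) u (fu u) /\ 0 < fu u,
        0 < f e 0,
        f e u @[u --> 1^'-] --> +oo &
        (\int[@lebesgue_measure R]_(u in `[0%R, 1%R[) (f e u)%:E)%E = +oo%E])
  /\ (forall u : R, 0 <= u < 1 ->
        exists m M : R, 0 < m /\ forall e, E e -> m <= f e u <= M).

(* Solution on [t0, Tq[ of v' = F v, v t0 = v0. The end of the interval may be
   infinite, and v is required to be continuous up to the initial time. *)
Definition is_solution (R : realType) (n : nat) (F : 'cV[R]_n -> 'cV[R]_n)
    (t0 : R) (Tq : \bar R) (v0 : 'cV[R]_n) (v : R -> 'cV[R]_n) : Prop :=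
  [/\ {within [set t : R | t0 <= t /\ (t%:E < Tq)%E], continuous v},
      forall t : R, t0 < t -> (t%:E < Tq)%E ->
        is_derive t (1 : R) v (F (v t)) &
      v t0 = v0].

(* Main.v *)
Require Import Defs.
From mathcomp Require Import all_boot all_order all_algebra.
From mathcomp Require Import all_classical all_reals all_analysis.
From mathcomp Require Import mxtens ring lra.

Import Order.TTheory GRing.Theory Num.Theory.
Import numFieldNormedType.Exports.

Set Implicit Arguments.
Unset Strict Implicit.
Unset Printing Implicit Defensive.

Local Open Scope classical_set_scope.
Local Open Scope ring_scope.

(** Write the system as v' = F(v) with F(w) = M w + g(w). It is cooperative:
    the off-diagonal entries of M are nonnegative and f increases in u, so for
    u <= w in the box [0,1)^n,
      F_k(w) - F_k(u) >= M_kk (w_k - u_k).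
    A cooperative autonomous system that starts by increasing keeps increasing.
    Indeed F(v0) > 0 and continuity of F give F(v(t)) > 0 on a short interval
    [t0, t0 + eta], hence v(t0) < v(t0 + d) for every 0 < d <= eta. Fix such a
    d and compare v with its translate: the difference
    w(t) = v(t + d) - v(t) is positive at t0, and as long as w >= 0 it
    satisfies w_k' >= M_kk w_k, so e^(- M_kk t) w_k is nondecreasing and w_k
    cannot reach 0 at a first time. Thus v(t) < v(t + d) for all t and all
    d <= eta, and finitely many such steps join any s < t.

    Comparing translates stands in for the differential inequality that v'
    satisfies, which would require v to be twice differentiable.
    [cooperative_gt0] is the first-exit argument, [cooperative_increasing] the
    monotonicity theorem for general cooperative F; the remaining lemmas check
    its hypotheses for the semi-discretized equation. *)

(** * Limits and derivatives relative to a set *)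

Lemma cvg_within_image (T U : topologicalType) (A : set T) (B : set U)
    (h : T -> U) (p : T) (q : U) :
  h s @[s --> within A (nbhs p)] --> q -> (forall s, A s -> B (h s)) ->
  h s @[s --> within A (nbhs p)] --> within B (nbhs q).
Proof.
move=> hq AB Q BQ.
have hQ : \forall s \near p, A s -> B (h s) -> Q (h s) := hq _ BQ.
suff : \forall s \near p, A s -> Q (h s) by [].
near=> s => As; exact: (near hQ s _ As (AB s As)).
Unshelve. all: by end_near. Qed.

Lemma is_derive_coord (R : realType) (n : nat) (v : R -> 'cV[R]_n) (t : R)
    (dv : 'cV[R]_n) (k : 'I_n) :
  is_derive t 1 v dv -> is_derive t 1 (fun s => v s k 0) (dv k 0).
Proof.
move=> [dv_ex dvE]; apply: DeriveDef; first exact: (derivable_mxP _ _ _).1.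
by rewrite -dvE derive_mx// mxE.
Qed.

Lemma is_derive_shift_arg (R : realType) (w : R -> R) (dw t r : R) :
  is_derive (t + r) 1 w dw -> is_derive t 1 (fun s => w (s + r)) dw.
Proof.
move=> wP; rewrite -[dw]mulr1.
exact: (@is_derive1_comp _ w (shift r) t dw 1 wP (is_derive_shift t 1 r)).
Qed.

(** At an interior point of A, being relative to A restricts nothing nearby,
    and w = h + u turns one difference quotient into the other. *)
Lemma is_derive_within_interior (R : realType) (A : set R) (phi : R -> R)
    (u l : R) :
  interior A u -> is_derive_within A phi u l -> is_derive u 1 phi l.
Proof.
move=> Au phi'.
suff H : h^-1 *: ((phi \o shift u) (h *: 1) - phi u) @[h --> 0^'] --> l.
  by apply: DeriveDef; [apply/cvg_ex; exists l | exact: cvg_lim H].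
have shiftu : (h + u) @[h --> 0^'] --> within A u^'.
  move=> /= P; rewrite /within/= => AP.
  have : \forall w \near u, w != u -> P w.
    by apply: filterS2 _ Au AP => w Aw APw wu; exact: APw.
  rewrite /dnbhs /within/= => HP.
  have : \forall h \near (0:R), h + u != u -> P (h + u).
    have hu : h + u @[h --> (0:R)] --> u.
      rewrite -[in X in _ --> X](add0r u).
      by apply: cvgD; [exact: cvg_id | exact: cvg_cst].
    exact: hu HP.
  apply: filterS => h hP h0; apply: hP.
  by rewrite -subr_eq0 addrK.
have := cvg_comp _ _ shiftu phi'; apply: cvg_trans; apply: near_eq_cvg.
by near=> h; rewrite /= addrK /GRing.scale/= mulr1 mulrC.
Unshelve. all: by end_near. Qed.

(** phi w = q(w) (w - u) + phi u, where the quotient q has a finite limit. *)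
Lemma is_derive_within_cvg (R : realType) (A : set R) (phi : R -> R)
    (u l : R) :
  is_derive_within A phi u l ->
  phi w @[w --> within A (nbhs u)] --> phi u.
Proof.
move=> phi'.
have FA : Filter (within A u^') by exact: within_filter.
have Adu : w - u @[w --> within A u^'] --> (0 : R).
  apply: cvg_within_filter.
  have : w - u @[w --> u] --> u - u by apply: cvgB; [exact: cvg_id|exact: cvg_cst].
  rewrite subrr => H P /H; exact: nbhs_dnbhs.
have H := cvgD (cvgM phi' Adu) (cvg_cst (phi u)).
rewrite mulr0 add0r in H.
have {}H := H FA FA FA.
move=> P Pu; have Pphi := nbhs_singleton Pu.
have HP : \forall w \near u, w != u -> A w ->
    P ((phi w - phi u) / (w - u) * (w - u) + phi u) := H P Pu.
suff : \forall w \near u, A w -> P (phi w) by [].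
near=> w => Aw; have [-> //|wu] := eqVneq w u.
have : P ((phi w - phi u) / (w - u) * (w - u) + phi u) by exact: (near HP w).
by rewrite divfK ?subr_eq0// subrK.
Unshelve. all: by end_near. Qed.

(** * First-exit argument for cooperative systems *)

(** The integrating factor e^(c t) makes e^(c t) w(t) nondecreasing, and its
    sign is that of w. *)
Lemma gronwall_gt0 (R : realType) (w w' : R -> R) (a b c : R) :
  a <= b -> {within `[a, b], continuous w} ->
  (forall t, a < t < b -> is_derive t 1 w (w' t)) ->
  (forall t, a < t < b -> - c * w t <= w' t) ->
  0 < w a -> 0 < w b.
Proof.
move=> ab cw dw w'ge wa.
pose E t := expR (c * t).
have dE (t : R) : is_derive t 1 E (E t * c).
  apply: is_derive1_comp.
  have : is_derive t (1 : R) (c \*: (@id R)) (c *: (1 : R)) by exact: is_deriveZ.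
  by rewrite /GRing.scale/= mulr1.
have dEw (t : R) : a < t < b -> is_derive t 1 (E * w) (E t * w' t + w t * (E t * c)).
  by move=> /dw ?; apply: is_deriveM.
suff : E a * w a <= E b * w b.
  by move=> /(lt_le_trans (mulr_gt0 (expR_gt0 _) wa)); rewrite pmulr_rgt0 ?expR_gt0.
apply: (@ger0_derive1_le_cc _ (E * w) a b) => //; rewrite ?in_itv/= ?lexx ?ab//.
- by move=> t; rewrite in_itv/= => /dEw[].
- move=> t; rewrite in_itv/= => atb; have [_] := dEw _ atb.
  rewrite -derive1E => ->.
  rewrite (_ : _ + _ = E t * (w' t - - c * w t)); last by ring.
  by rewrite mulr_ge0 ?expR_ge0// subr_ge0 w'ge.
- have cE : {within `[a, b], continuous E}.
    apply: continuous_subspaceT => t; apply: differentiable_continuous.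
    by apply/derivable1_diffP; have [] := dE t.
  move=> t; apply: cvgM; [exact: cE | exact: cw].
Qed.

(** The differential inequality is only available while all components are
    nonnegative, which is what couples them. Before the first time T at which
    some component is nonpositive, all are positive, so the scalar bound
    applies to each of them on [a, T] and all are still positive at T; by
    continuity they stay so a little longer, against the choice of T. *)
Lemma cooperative_gt0 (R : realType) (I : finType) (w w' : I -> R -> R)
    (c : I -> R) (a b : R) :
  a <= b ->
  (forall k, {within `[a, b], continuous (w k)}) ->
  (forall k t, a < t < b -> is_derive t 1 (w k) (w' k t)) ->
  (forall k t, a < t < b -> (forall l, 0 <= w l t) ->
     - c k * w k t <= w' k t) ->
  (forall k, 0 < w k a) ->
  forall t, a <= t <= b -> forall k, 0 < w k t.
Proof.
move=> ab cw dw w'ge wa.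
pose Z := [set t | a <= t <= b /\ exists k, w k t <= 0].
suff Z0 : ~ (Z !=set0).
  move=> t atb k; rewrite ltNge; apply/negP => wk0.
  by apply: Z0; exists t; split=> //; exists k.
move=> Zn0.
have Zlb : lbound Z a by move=> t [/andP[]].
have hZ : has_inf Z by split=> //; exists a.
set T := inf Z.
have aT : a <= T by exact: lb_le_inf.
have Tb : T <= b.
  case: Zn0 => z Zz; have /andP[_ zb] := Zz.1.
  by apply: le_trans zb; apply: ge_inf => //; exists a.
have wpos t k : a <= t -> t < T -> 0 < w k t.
  move=> at_ tT; rewrite ltNge; apply/negP => wk0.
  have Zt : Z t by split; [rewrite at_ (le_trans (ltW tT) Tb) | exists k].
  by move: tT; rewrite ltNge ge_inf//; exists a.
have wT k : 0 < w k T.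
  apply: (@gronwall_gt0 _ (w k) (w' k) a T (c k)) => //.
  - apply: continuous_subspaceW (cw k).
    by move=> t /=; rewrite !in_itv/= => /andP[-> /le_trans->].
  - by move=> t /andP[at_ tT]; apply: dw; rewrite at_ (lt_le_trans tT Tb).
  - move=> t /andP[at_ tT]; apply: w'ge; first by rewrite at_ (lt_le_trans tT Tb).
    by move=> l; apply/ltW/wpos => //; exact: ltW.
have near_pos : \forall t \near within `[a, b] (nbhs T), forall k, 0 < w k t.
  apply: filter_forall => k.
  have /subspace_continuousP/(_ T) := cw k.
  rewrite /= in_itv/= aT Tb => /(_ isT) /cvgr_gt; apply; exact: wT.
have /nbhs_ballP[e /= e0 eP] : \forall t \near T,
    `[a, b]%classic t -> forall k, 0 < w k t := near_pos.
have [z Zz zT] := inf_adherent e0 hZ.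
have [/andP[az zb] [k]] := Zz.
rewrite leNgt => /negP; apply.
apply: eP; last by rewrite /= in_itv/= az.
rewrite /ball/= distrC ger0_norm ?subr_ge0; last by apply: ge_inf => //; exists a.
by rewrite ltrBlDl.
Qed.

(** * Monotonicity of solutions of cooperative systems *)

(** The translation by r lets the same fact serve for t |-> v (t + r). *)
Lemma solution_coord_within (R : realType) (n : nat)
    (F : 'cV[R]_n -> 'cV[R]_n) (t0 : R) (Tq : \bar R) (v0 : 'cV[R]_n)
    (v : R -> 'cV[R]_n) (a b r : R) (k : 'I_n) :
  is_solution F t0 Tq v0 v -> t0 <= a + r -> ((b + r)%:E < Tq)%E ->
  {within `[a, b], continuous (fun t => v (t + r) k 0)}.
Proof.
move=> [cv _ _] ar br.
have shiftJ (t : R) : a <= t <= b -> t0 <= t + r /\ ((t + r)%:E < Tq)%E.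
  move=> /andP[at_ tb]; split; first by rewrite (le_trans ar)// lerD2r.
  by apply: le_lt_trans br; rewrite lee_fin lerD2r.
apply/subspace_continuousP => t /=; rewrite in_itv/= => atb.
have /subspace_continuousP/(_ (t + r) (shiftJ _ atb)) cvt := cv.
have cshift : s + r @[s --> within `[a, b] (nbhs t)] -->
    within [set t | t0 <= t /\ (t%:E < Tq)%E] (nbhs (t + r)).
  apply: cvg_within_image => [|s]; last by rewrite /= in_itv/=; exact: shiftJ.
  by apply: cvg_within_filter; apply: cvgD; [exact: cvg_id | exact: cvg_cst].
have := cvg_comp _ _ (cvg_comp _ _ cshift cvt) (@coord_continuous _ _ _ k 0 _).
exact.
Qed.

(** The one-sided bound on F is quasi-monotonicity with a linear loss: raising
    the other components cannot lower F_k, raising the k-th one lowers it at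
    most at rate c. It is assumed on D only, where v is known to stay. *)
Lemma cooperative_increasing (R : realType) (n : nat)
    (F : 'cV[R]_n -> 'cV[R]_n) (D : set 'cV[R]_n) (t0 : R) (Tq : \bar R)
    (v0 : 'cV[R]_n) (v : R -> 'cV[R]_n) :
  is_solution F t0 Tq v0 v -> (t0%:E < Tq)%E ->
  (forall t, t0 <= t -> (t%:E < Tq)%E -> D (v t)) ->
  (forall k, {within D, continuous (fun w => F w k 0)}) ->
  (forall k, exists c, forall u w, D u -> D w -> vle u w ->
     - c * (w k 0 - u k 0) <= F w k 0 - F u k 0) ->
  vlt 0 (F v0) ->
  forall s t, t0 <= s -> s < t -> (t%:E < Tq)%E -> vlt (v s) (v t).
Proof.
move=> sol t0T vD cF /choice[c coopF] F0.
have [cv dv vt0] := sol.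
have dvk (r t : R) (k : 'I_n) : t0 < t + r -> ((t + r)%:E < Tq)%E ->
    is_derive t 1 (fun s => v (s + r) k 0) (F (v (t + r)) k 0).
  move=> t0t tT; apply: (@is_derive_shift_arg _ (fun s => v s k 0)).
  exact/is_derive_coord/dv.
have cvk (a b r : R) (k : 'I_n) : t0 <= a + r -> ((b + r)%:E < Tq)%E ->
    {within `[a, b], continuous (fun t => v (t + r) k 0)}.
  exact: solution_coord_within sol.
have v_addr0 (k : 'I_n) : (fun t => v (t + 0) k 0) = (fun t => v t k 0).
  by apply/funext => t; rewrite addr0.
have [eta eta0 [etaT etaF]] : exists2 eta, 0 < eta &
    ((t0 + eta)%:E < Tq)%E /\
    forall t, t0 <= t <= t0 + eta -> vlt 0 (F (v t)).
  pose J := [set t : R | t0 <= t /\ (t%:E < Tq)%E].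
  have Jt0 : J t0 by [].
  have near_pos : \forall t \near within J (nbhs t0), forall k, 0 < F (v t) k 0.
    apply: filter_forall => k.
    have vD0 : v t @[t --> within J (nbhs t0)] --> within D (nbhs v0).
      apply: cvg_within_image => [|t [t0t tT]]; last exact: vD.
      by have /subspace_continuousP/(_ t0 Jt0) := cv; rewrite /from_subspace vt0.
    have D0 : D v0 by rewrite -vt0; exact: vD.
    have /subspace_continuousP/(_ v0 D0) cFk := cF k.
    have := cvg_comp _ _ vD0 cFk; move=> /cvgr_gt; apply.
    by have := F0 k; rewrite mxE.
  have /nbhs_ballP[e /= e0 eP] : \forall t \near t0,
      J t -> forall k, 0 < F (v t) k 0 := near_pos.
  have [d d0 dT] : exists2 d : R, 0 < d & ((t0 + d)%:E < Tq)%E.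
    case: Tq t0T {sol vD cv dv dvk cvk J Jt0 near_pos eP} => [r| |]//.
    - rewrite lte_fin => t0r; exists ((r - t0) / 2); first by lra.
      by rewrite lte_fin; lra.
    - by exists 1 => //; rewrite ltry.
  exists (Num.min d (e / 2)); first by rewrite lt_min d0 divr_gt0.
  have minT : ((t0 + Num.min d (e / 2))%:E < Tq)%E.
    by apply: le_lt_trans dT; rewrite lee_fin lerD2l ge_min lexx.
  split=> // t /andP[t0t tle] k; rewrite mxE; apply: eP; last first.
    by split=> //; apply: le_lt_trans minT; rewrite lee_fin.
  rewrite /ball/= distrC ger0_norm ?subr_ge0//.
  have : Num.min d (e / 2) <= e / 2 by rewrite ge_min lexx orbT.
  by move: tle; lra.
(* The derivative F (v t) is positive on ]t0, t0 + eta]. *)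
have start d : 0 < d -> d <= eta -> vlt (v t0) (v (t0 + d)).
  move=> d0 deta k.
  have dT : ((t0 + d)%:E < Tq)%E.
    by apply: le_lt_trans etaT; rewrite lee_fin lerD2l.
  have dvt (t : R) : t \in `]t0, t0 + d[ ->
      is_derive t 1 (fun s => v s k 0) (F (v t) k 0).
    rewrite in_itv/= => /andP[t0t td]; apply/is_derive_coord/dv => //.
    by apply: lt_trans dT; rewrite lte_fin.
  apply: (@gtr0_derive1_lt_cc _ (fun s => v s k 0) t0 (t0 + d)).
  - by move=> t /dvt[].
  - move=> t ttd; have [_] := dvt t ttd; rewrite derive1E => ->.
    move: ttd; rewrite in_itv/= => /andP[t0t td].
    have := etaF t; rewrite (ltW t0t) (le_trans (ltW td)) ?lerD2l//.
    by move=> /(_ isT k); rewrite mxE.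
  - by rewrite -v_addr0; apply: cvk; rewrite addr0.
  - by rewrite in_itv/= lexx lerDl ltW.
  - by rewrite in_itv/= lexx lerDl ltW.
  - by rewrite ltrDl.
(* The difference of the two solutions v (_ + d) and v starts positive and
   inherits the cooperative inequality from F. *)
have shift_lt d t : 0 < d -> d <= eta -> t0 <= t -> ((t + d)%:E < Tq)%E ->
    vlt (v t) (v (t + d)).
  move=> d0 deta t0t tdT k; rewrite -subr_gt0.
  have inT s : s <= t -> (s%:E < Tq)%E /\ ((s + d)%:E < Tq)%E.
    by move=> st; split; apply: le_lt_trans tdT; rewrite lee_fin; lra.
  apply: (@cooperative_gt0 _ _ (fun l s => v (s + d) l 0 - v s l 0)
    (fun l s => F (v (s + d)) l 0 - F (v s) l 0) c t0 t) => //.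
  - move=> l; apply: within_continuousB; first by apply: cvk => //; lra.
    rewrite -v_addr0; apply: cvk; rewrite ?addr0//.
    by have [] := inT t (lexx _).
  - move=> l s /andP[t0s st]; have [sT sdT] := inT s (ltW st).
    apply: is_deriveB; first by apply: dvk => //; lra.
    exact/is_derive_coord/dv.
  - move=> l s /andP[t0s st] w0; have [sT sdT] := inT s (ltW st).
    apply: coopF; [by apply: vD => //; exact: ltW|apply: vD => //; lra|].
    by move=> m; rewrite -subr_ge0.
  - by move=> l; rewrite subr_gt0; exact: start.
  - by rewrite t0t lexx.
(* Cover [s, t] by at most m steps of length eta, the last one shorter. *)
have chain m s t : t0 <= s -> s < t -> (t%:E < Tq)%E -> t - s <= m%:R * eta ->
    vlt (v s) (v t).
  elim: m s => [|m IH] s t0s st tT; first by rewrite mul0r; lra.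
  rewrite mulrS mulrDl mul1r => tsm.
  have [ts|ts] := leP (t - s) eta.
    by rewrite -(subrKC s t); apply: shift_lt => //; rewrite ?subr_gt0 ?subrKC.
  have seta : ((s + eta)%:E < Tq)%E.
    by apply: lt_trans tT; rewrite lte_fin; lra.
  have lt1 := shift_lt eta s eta0 (lexx _) t0s seta.
  have lt2 : vlt (v (s + eta)) (v t) by apply: IH => //; lra.
  by move=> k; exact: lt_trans (lt1 k) (lt2 k).
move=> s t t0s st tT.
apply: (chain (Num.bound ((t - s) / eta))) => //.
by rewrite -ler_pdivrMr//; apply/ltW/archi_boundP/divr_ge0; lra.
Qed.

(** * Mesh, degeneracy and discretization matrix *)

Lemma mesh_lt (R : realType) (N : nat) (x : nat -> R) (i j : nat) :
  is_mesh N x -> (i < j)%N -> (j <= N.+1)%N -> x i < x j.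
Proof.
move=> [_ _ xS]; elim: j => // j IH; rewrite ltnS leq_eqVlt => /predU1P[<-|ij] jN.
  exact: xS.
by apply: lt_trans (xS j jN); apply: IH => //; exact: leqW.
Qed.

Lemma mesh_interior (R : realType) (N : nat) (x : nat -> R) (i : nat) :
  is_mesh N x -> (i < N)%N -> -1 < x i.+1 < 1.
Proof.
move=> hx iN; have [<- <- _] := hx.
by rewrite !(mesh_lt hx)// ltnS ltnW.
Qed.

Lemma tridiag_offdiag_ge0 (R : realType) (N : nat) (x : nat -> R)
    (i j : 'I_N) : is_mesh N x -> i != j -> 0 <= tridiag N x i j.
Proof.
move=> [_ _ xS] ij; rewrite mxE.
have h0 m : (m <= N)%N -> 0 <= step x m.
  by move=> mN; rewrite subr_ge0 ltW// xS.
rewrite eq_sym (negPf (ij : i != j :> nat)).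
have [iN jN] := (ltn_ord i, ltn_ord j).
case: eqP => [ji|_].
  by apply/divr_ge0/mulr_ge0/addr_ge0 => //; apply: h0; rewrite // ltnW.
case: eqP => // ji.
by apply/divr_ge0/mulr_ge0/addr_ge0 => //; apply: h0; rewrite -ji // ltnW.
Qed.

Lemma node_square (R : realType) (Nx Ny : nat) (x y : nat -> R)
    (k : 'I_(Ny * Nx)) :
  is_mesh Nx x -> is_mesh Ny y -> square (node x y k).
Proof.
move=> hx hy; split; rewrite /= in_itv/=;
  [exact: (mesh_interior hx (ltn_ord (mxtens_unindex k).2))
  |exact: (mesh_interior hy (ltn_ord (mxtens_unindex k).1))].
Qed.

(** The zeros of sigma lie off the interior, and the square is open. *)
Lemma degeneracy_gt0 (R : realType) (sigma : R * R -> R) (p : R * R) :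
  degeneracy sigma -> square p -> 0 < sigma p.
Proof.
move=> [sge0 s0] sqp; have clp := @subset_closure _ (@square R) p sqp.
rewrite lt0r sge0// andbT; apply/eqP => /(s0 _ clp)[_]; apply.
have [] : nbhs p.1 `]-1, 1[%classic /\ nbhs p.2 `]-1, 1[%classic.
  by case: sqp; split; exact: open_nbhs_nbhs.
by exists (`]-1, 1[%classic, `]-1, 1[%classic) => // q.
Qed.

(** Distinct nodes differ in some coordinate. If they differ in both, each
    Kronecker product vanishes through its identity factor; otherwise only the
    one-dimensional operator of the differing coordinate survives, at an
    off-diagonal entry. *)
Lemma Mmx_offdiag_ge0 (R : realType) (Nx Ny : nat) (a b : R) (x y : nat -> R)
    (sigma : R * R -> R) (k l : 'I_(Ny * Nx)) :
  is_mesh Nx x -> is_mesh Ny y -> degeneracy sigma ->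
  k != l -> 0 <= Mmx Nx Ny a b x y sigma k l.
Proof.
move=> hx hy hs kl; rewrite /Mmx /Bmx !mul_diag_mx.
have := @tridiag_offdiag_ge0 _ Nx x; have := @tridiag_offdiag_ge0 _ Ny y.
move: (tridiag Nx x) (tridiag Ny y) => Tx Ty Ty0 Tx0; rewrite !mxE.
have s0 : 0 <= (sigma (node x y k))^-1.
  by rewrite invr_ge0 ltW// degeneracy_gt0//; apply: node_square.
have inv_sqr_ge0 (z : R) : 0 <= z ^- 2 by rewrite invr_ge0 sqr_ge0.
have [e1|n1] := eqVneq (mxtens_unindex k).1 (mxtens_unindex l).1;
  have [e2|n2] := eqVneq (mxtens_unindex k).2 (mxtens_unindex l).2.
- case/eqP: kl; apply: (can_inj (@mxtens_unindexK _ _)).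
  by rewrite [LHS]surjective_pairing e1 e2 -surjective_pairing.
- by rewrite mul1r !mulr0 addr0 !mulr_ge0// Tx0.
- by rewrite mul0r mulr1 !mulr0 add0r !mulr_ge0// Ty0.
- by rewrite mul0r !mulr0 addr0.
Qed.

(** * Reaction term *)

Lemma reaction_continuous (R : realType) (E : set R) (f : R -> R -> R) (e : R) :
  reaction E f -> E e -> {within `[0, 1[%classic, continuous (f e)}.
Proof.
move=> [hf _] /hf[[fu _ f'] _ _ _]; apply/subspace_continuousP => u.
rewrite /= in_itv/= => u01; have [fu' _] := f' u u01.
exact: is_derive_within_cvg fu'.
Qed.

Lemma reaction_nondecreasing (R : realType) (E : set R) (f : R -> R -> R)
    (e : R) : reaction E f -> E e ->
  forall u w : R, 0 <= u -> u <= w -> w < 1 -> f e u <= f e w.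
Proof.
move=> hf Ee u w u0 uw w1; have cf := reaction_continuous hf Ee.
have [[fu _ f'] _ _ _] := hf.1 e Ee.
have df (t : R) : t \in `]0, 1[ -> is_derive t 1 (f e) (fu t) /\ 0 < fu t.
  move=> t01; have t01' : 0 <= t < 1.
    by move: t01; rewrite in_itv/= => /andP[/ltW-> ->].
  have [f't fut] := f' t t01'; split=> //.
  apply: is_derive_within_interior f't.
  have : nbhs t `]0, 1[%classic by exact: open_nbhs_nbhs.
  by apply: filterS => q /=; rewrite !in_itv/= => /andP[/ltW-> ->].
apply: (@ger0_derive1_le_co _ (f e) 0 1) => //.
- by move=> t /df[[]].
- by move=> t /df[[_ dft] fut]; rewrite derive1E dft ltW.
- by rewrite in_itv/= u0 (le_lt_trans uw).
- by rewrite in_itv/= (le_trans u0 uw).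
Qed.

(** * The semi-discretized equation *)

(** The off-diagonal terms of the sum are nonnegative; the diagonal one is the
    left-hand side. *)
Lemma mulmx_cooperative (R : realType) (n : nat) (A : 'M[R]_n)
    (u w : 'cV[R]_n) (k : 'I_n) :
  (forall l, k != l -> 0 <= A k l) -> vle u w ->
  A k k * (w k 0 - u k 0) <= (A *m w) k 0 - (A *m u) k 0.
Proof.
move=> A0 uw; rewrite !mxE -sumrB (bigD1 k)//= mulrBr lerDl.
apply: sumr_ge0 => l lk; rewrite -mulrBr mulr_ge0 ?subr_ge0//.
by apply: A0; rewrite eq_sym.
Qed.

Lemma mulmx_coord_continuous (R : realType) (n : nat) (A : 'M[R]_n)
    (k : 'I_n) : continuous (fun w : 'cV[R]_n => (A *m w) k 0).
Proof.
rewrite (_ : (fun w : 'cV[R]_n => _) = fun w => \sum_l A k l * w l 0); last first.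
  by apply/funext => w; rewrite mxE.
apply: (continuous_big (@add_continuous R)) => l _ w.
have cl := @coord_continuous R n 1 l 0 w.
exact: (@cvgMl_tmp _ _ (nbhs w) _ _ (A k l) _ cl).
Qed.

Theorem lemma4p1 (R : realType) (a b : R) (Nx Ny : nat) (x y : nat -> R)
    (sigma : R * R -> R)
    (d : measure_display) (Omega : measurableType d) (P : probability Omega R)
    (eps : R * R -> {RV P >-> R}) (f : R -> R -> R)
    (ha : 0 < a) (hb : 0 < b) (hNx : (0 < Nx)%N) (hNy : (0 < Ny)%N)
    (hx : is_mesh Nx x) (hy : is_mesh Ny y)
    (hsigma : degeneracy sigma)
    (heps : exists C : R, forall p, @square R p ->
       forall omega, `|eps p omega| <= C)
    (hf : reaction
       [set e | exists p omega, @square R p /\ eps p omega = e] f)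
    (omega : Omega) (t0 : R) (Tq : \bar R) (hT : (t0%:E < Tq)%E)
    (v0 : 'cV[R]_(Ny * Nx)) (v : R -> 'cV[R]_(Ny * Nx)) :
  let M := Mmx Nx Ny a b x y sigma in
  let g := gvec x y sigma f (fun p => eps p omega) in
  is_solution (fun w => M *m w + g w) t0 Tq v0 v ->
  (forall t : R, t0 <= t -> (t%:E < Tq)%E ->
     vle 0 (v t) /\ vlt (v t) (const_mx 1)) ->
  vlt 0 (M *m v0 + g v0) ->
  forall s t : R, t0 < s -> s < t -> (t%:E < Tq)%E -> vlt (v s) (v t).
Proof.
move=> M g sol v01 F0 s t /ltW t0s.
pose D := [set w : 'cV[R]_(Ny * Nx) | vle 0 w /\ vlt w (const_mx 1)].
have D01 w (k : 'I_(Ny * Nx)) : D w -> 0 <= w k 0 < 1.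
  by move=> [/(_ k) + /(_ k)]; rewrite !mxE => -> ->.
have Ee (k : 'I_(Ny * Nx)) : [set e | exists p omega, @square R p /\ eps p omega = e]
    (eps (node x y k) omega).
  by exists (node x y k), omega; split=> //; exact: (node_square k hx hy).
have s_gt0 (k : 'I_(Ny * Nx)) : 0 < sigma (node x y k).
  exact: degeneracy_gt0 hsigma (node_square k hx hy).
have FE (k : 'I_(Ny * Nx)) z : (M *m z + g z) k 0 =
    (M *m z) k 0 + f (eps (node x y k) omega) (z k 0) / sigma (node x y k).
  by rewrite mxE [g z k 0]mxE.
apply: (@cooperative_increasing _ _ _ D t0 Tq v0 v sol) => // k.
- rewrite (funext (FE k)).
  apply/subspace_continuousP => w Dw; apply: cvgD.
    exact: (@cvg_within_filter _ _ _ (nbhs w) _ _ D (@mulmx_coord_continuous _ _ M k w)).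
  apply: cvgMr_tmp.
  have /subspace_continuousP/(_ (w k 0)) := reaction_continuous hf (Ee k).
  rewrite /= in_itv/= D01// => /(_ isT) cfk.
  apply: cvg_comp cfk; apply: cvg_within_image => [|z Dz]; last first.
    by rewrite /= in_itv/= D01.
  exact: (@cvg_within_filter _ _ _ (nbhs w) _ _ D (@coord_continuous _ _ _ k 0 w)).
- exists (- M k k) => u w Du Dw uw; rewrite opprK.
  apply: (le_trans (@mulmx_cooperative _ _ M u w k _ uw)).
    by move=> l; exact: Mmx_offdiag_ge0.
  rewrite !FE opprD addrACA lerDl -mulrBl divr_ge0 ?subr_ge0 ?(ltW (s_gt0 k))//.
  have [/andP[u0 _] /andP[_ w1]] := (D01 u k Du, D01 w k Dw).
  exact: (reaction_nondecreasing hf (Ee k)).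
Qed.
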